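(* The hydrodynamic type system $$r^i_t=V_i(\mathbf r)\,r^i_x,\qquad i=1,2,\dots,N,$$ with an arbitrary number $N$ of components and with $V_i\neq V_k$ for any $i\neq k$, is embedded into the hydrodynamic chain $$\partial_t c_k=\partial_x c_{k+1}-c_1\,\partial_x c_k,\qquad k=0,\pm1,\pm2,\dots,$$ if and only if $$V_i=f_i(r^i)-c_1,\qquad c_1=\sum_{m=1}^N\psi_m(r^m),$$ where $f_i(r^i)$ and $\psi_k(r^k)$ are arbitrary functions (each of a single variable).
   Context: Here $\mathbf r=(r^1,\dots,r^N)$ are the Riemann invariants, functions of the independent variables $x,t$; there is no summation over the repeated index $i$; $\partial_i=\partial/\partial r^i$; and the infinitely many field variables $c_k$, $k\in\mathbb Z$, of the chain are called moments. The system is said to be embedded into the chain (it is a hydrodynamic reduction of the chain) if every moment $c_k$ can be expressed as a function $c_k(\mathbf r)$ of the $N$ independent Riemann invariants so that the equations of the chain hold by virtue of the system, i.e. $$V_i\,\partial_i c_k=\partial_i c_{k+1}-c_1\,\partial_i c_k,\qquad i=1,\dots,N,\quad k=0,\pm1,\pm2,\dots$$ The function $c_1$ in the claim is the moment of index $1$.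
   Formalization: On a box of open intervals with V_i of class C^1 and the moments C^2, ''only if'' assumes no ∂_i c_1 vanishes on an open set (constant moments embed every system); ''if'' assumes f_i = V_i + c_1 has no zeros (else c_0 may be singular, e.g. N=1, f=ψ=r). *)

(* Defs.v *)
From HB Require Import structures.
From mathcomp Require Import all_boot all_order all_algebra.
From mathcomp Require Import all_classical all_reals all_analysis.
Import Order.TTheory GRing.Theory Num.Theory.
Import numFieldNormedType.Exports.

Set Implicit Arguments.
Unset Strict Implicit.
Unset Printing Implicit Defensive.

Local Open Scope classical_set_scope.
Local Open Scope ring_scope.

(* The Riemann invariants (r^1, ..., r^N) are the coordinates of a row vector. *)
Definition dir {R : realType} {N : nat} (i : 'I_N) : 'rV[R]_N := delta_mx 0 i.

Definition partial {R : realType} {N : nat} (i : 'I_N) (g : 'rV[R]_N -> R) :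
  'rV[R]_N -> R := 'D_(dir i) (g : 'rV[R]_N -> R^o).

(* Functions of class C^n on D: meaningful for D open, since [partial] is a
   two-sided limit. *)
Fixpoint Cn_on {R : realType} {N : nat} (D : set 'rV[R]_N) (n : nat)
    (g : 'rV[R]_N -> R) : Prop :=
  match n with
  | 0%N => forall r, D r -> {for r, continuous g}
  | m.+1 =>
      (forall i r, D r -> derivable (g : 'rV[R]_N -> R^o) r (dir i)) /\
      (forall i, Cn_on D m (partial i g))
  end.

Definition box {R : realType} {N : nat} (I : 'I_N -> set R) : set 'rV[R]_N :=
  [set r | forall i, I i (r 0 i)].

(* The moments c_k, k in Z, are functions on D for which the chain
     d_t c_k = d_x c_{k+1} - c_1 d_x c_k
   holds by virtue of r^i_t = V_i(r) r^i_x: after the substitution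
   d_x c_k = \sum_i (d_i c_k) r^i_x and d_t c_k = \sum_i (d_i c_k) V_i r^i_x,
   the coefficients of the r^i_x, which are arbitrary, are equated. *)
Definition hydrodynamic_reduction {R : realType} {N : nat} (D : set 'rV[R]_N)
    (V : 'I_N -> 'rV[R]_N -> R) (c : int -> 'rV[R]_N -> R) : Prop :=
  (forall k, Cn_on D 2 (c k)) /\
  (forall k i r, D r ->
     V i r * partial i (c k) r
     = partial i (c (k + 1)) r - c 1 r * partial i (c k) r).

Definition embedded_with_first_moment {R : realType} {N : nat}
    (D : set 'rV[R]_N) (V : 'I_N -> 'rV[R]_N -> R) (c1 : 'rV[R]_N -> R) : Prop :=
  exists c : int -> 'rV[R]_N -> R,
    hydrodynamic_reduction D V c /\ (forall r, D r -> c 1 r = c1 r).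

(* No regularity is asked of f and psi: on a box it is inherited from that of
   V and c1. *)
Definition separated_form {R : realType} {N : nat} (D : set 'rV[R]_N)
    (V : 'I_N -> 'rV[R]_N -> R) (c1 : 'rV[R]_N -> R) : Prop :=
  exists f psi : 'I_N -> R -> R,
    (forall i r, D r -> V i r = f i (r 0 i) - c1 r) /\
    (forall r, D r -> c1 r = \sum_(m < N) psi m (r 0 m)).

(* No Riemann invariant drops out of c1 on any open part of D. If the chain
   holds, this says the same as that no Riemann invariant drops out of the whole
   family of moments, because d_i c_{k+1} = (V_i + c_1) d_i c_k. Without it the
   constant moments embed every system into the chain. *)
Definition depends_on_all {R : realType} {N : nat} (D : set 'rV[R]_N)
    (c1 : 'rV[R]_N -> R) : Prop :=
  forall i, D `<=` closure [set r | D r /\ partial i c1 r != 0].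

(* The moments of index k <= 0 are obtained from d_i c_1 by dividing by powers
   of V_i + c_1, so a zero of V_i + c_1 can make them singular: with N = 1,
   V = 0 and c_1 = r, the moment c_0 would need r c_0' = 1. Near any given point
   the condition can be met by adding a constant to c1, i.e. to f_i and psi_1 in
   the decomposition of V. *)
Definition nonvanishing_shift {R : realType} {N : nat} (D : set 'rV[R]_N)
    (V : 'I_N -> 'rV[R]_N -> R) (c1 : 'rV[R]_N -> R) : Prop :=
  forall i r, D r -> V i r + c1 r != 0.

(* Main.v *)
Require Import Defs.
From mathcomp Require Import all_boot all_order all_algebra.
From mathcomp Require Import all_classical all_reals all_analysis.
From mathcomp Require Import ring lra.
Import Order.TTheory GRing.Theory Num.Theory.
Import numFieldNormedType.Exports.

(* Put W_i = V_i + c_1, so that the chain reads d_i c_{k+1} = W_i d_i c_k.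
   Equality of the mixed second derivatives of c_k, c_{k+1}, c_{k+2} gives
     d_i W_j d_j c_k + d_j W_i d_i c_k = 0,
   and the same relation for k + 1 carries the weights W_j and W_i. As
   W_i <> W_j, d_j W_i d_i c_k = 0; taking k = 1, density of {d_i c_1 <> 0}
   yields d_j W_i = 0 for i <> j, and then d_j d_i c_1 = 0. On a box this means
   that W_i depends on r^i alone and that c_1 is a sum of functions of one
   variable.
   Conversely, if W_i = f_i(r^i) and c_1 = sum_m psi_m(r^m), the moments are
   c_k = sum_m \int f_m^(k-1) psi_m' dr^m. *)

Set Implicit Arguments.
Unset Strict Implicit.
Unset Printing Implicit Defensive.

Local Open Scope classical_set_scope.
Local Open Scope ring_scope.

(** * Restriction to lines and the mean value theorem *)

(** The difference quotient of the restriction to the line is literally the one that defines the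
    directional derivative. *)
Lemma is_derive_line (R : realType) (V : normedModType R) (g : V -> R)
    (p v : V) (x : R) :
  derivable (g : V -> R^o) (p + x *: v) v ->
  is_derive x (1 : R) (fun s : R => g (p + s *: v) : R^o)
    ('D_v (g : V -> R^o) (p + x *: v)).
Proof.
move=> dg.
have E : (fun h : R => h^-1 *: ((g (p + (h *: (1 : R) + x) *: v) : R^o)
             - g (p + x *: v)))
   = (fun h : R => h^-1 *: ((g (h *: v + (p + x *: v)) : R^o)
             - g (p + x *: v))).
  apply/funext => h; congr (_ *: (g _ - _)).
  by rewrite [_ *: 1]mulr1 scalerDl addrCA.
apply: DeriveDef; last by rewrite /derive /= E.
by rewrite /derivable /= E.
Qed.

Lemma is_derive_continuous (R : realType) (h : R -> R) (x d : R) :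
  is_derive x (1 : R) (h : R -> R^o) d -> {for x, continuous h}.
Proof.
case=> dh _; apply: (@differentiable_continuous R R^o R^o).
exact/derivable1_diffP.
Qed.

Lemma mean_value (R : realType) (h dh : R -> R) (a b : R) :
  a <= b ->
  (forall x, a <= x <= b -> is_derive x (1 : R) (h : R -> R^o) (dh x)) ->
  exists2 c, a <= c <= b & h b - h a = dh c * (b - a).
Proof.
move=> ab dhP; have [||c] := @MVT_segment R h dh a b ab.
- by move=> x /[!in_itv]/= /andP[ax xb]; apply: dhP; rewrite !ltW.
- apply/continuous_in_subspaceT => x /[!inE]/= /[!in_itv]/= xab.
  exact: is_derive_continuous (dhP _ xab).
by rewrite in_itv/= => cab E; exists c.
Qed.

Lemma itv_lipschitz (R : realType) (J : set R) (h dh : R -> R) (M a b : R) :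
  is_interval J -> J a -> J b ->
  (forall x, J x -> is_derive x (1 : R) (h : R -> R^o) (dh x)) ->
  (forall x, J x -> `|dh x| <= M) ->
  `|h b - h a| <= M * `|b - a|.
Proof.
move=> Jitv + + hdh dhM.
wlog ab : a b / a <= b => [H Ja Jb|Ja Jb].
  by case/orP: (le_total a b) => ab; last rewrite distrC (distrC b); exact: H.
have [x xab|c cab ->] := mean_value ab (dh := dh) (h := h).
  exact/hdh/(Jitv _ _ Ja Jb).
by rewrite normrM ler_wpM2r//; exact/dhM/(Jitv _ _ Ja Jb).
Qed.

(** * Symmetry of mixed second derivatives *)

Lemma C2_derivable (R : realType) (N : nat) (D : set 'rV[R]_N)
    (g : 'rV[R]_N -> R) :
  Cn_on D 2 g ->
  [/\ forall i r, D r -> derivable (g : 'rV[R]_N -> R^o) r (dir i),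
      forall i j r, D r -> derivable (partial i g : 'rV[R]_N -> R^o) r (dir j) &
      forall i j r, D r -> {for r, continuous (partial j (partial i g))}].
Proof.
case=> dg H; split => [//|i j r Dr|i j r Dr]; have [dig cig] := H i.
  exact: dig.
exact: cig.
Qed.

Lemma ler_dist_common_point (R : realFieldType) (a b p q e : R) :
  `|a - p| < e / 2 -> `|b - q| < e / 2 -> p = q -> `|a - b| <= e.
Proof.
move=> ap bq pq; rewrite (le_trans (ler_distD p _ _))// (splitr e).
by rewrite lerD// ltW// distrC pq.
Qed.

(** Two mean value steps: the second difference is the increment over [0, s] of [phi], itself a
    difference along [s *: v]. The first step, in the direction [u], leaves an increment of ['D_u g]
    along [v], to which the second step applies. *)
Lemma mixed_difference (R : realType) (V : normedModType R) (D : set V)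
    (g : V -> R) (u v r : V) (s : R) :
  0 <= s ->
  (forall p, D p -> derivable (g : V -> R^o) p u) ->
  (forall p, D p -> derivable ('D_u (g : V -> R^o)) p v) ->
  (forall x y, 0 <= x <= s -> 0 <= y <= s -> D (r + x *: u + y *: v)) ->
  exists x y, [/\ 0 <= x <= s, 0 <= y <= s &
    g (r + s *: u + s *: v) - g (r + s *: u) - g (r + s *: v) + g r =
    'D_v ('D_u (g : V -> R^o)) (r + x *: u + y *: v) * s * s].
Proof.
move=> s0 du dvu Dxy.
have ss : 0 <= s <= s by rewrite s0 lexx.
have s00 : 0 <= (0 : R) <= s by rewrite s0 lexx.
pose phi x := g (r + s *: v + x *: u) - g (r + x *: u).
pose dphi x := 'D_u (g : V -> R^o) (r + s *: v + x *: u)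
               - 'D_u (g : V -> R^o) (r + x *: u).
have [x xs|x xs Ex] := @mean_value R phi dphi 0 s s0.
  have D1 : D (r + s *: v + x *: u) by rewrite addrAC; exact: Dxy.
  have D2 : D (r + x *: u) by have := Dxy x 0 xs s00; rewrite scale0r addr0.
  have H1 := @is_derive_line R V g (r + s *: v) u x (du _ D1).
  have H2 := @is_derive_line R V g r u x (du _ D2).
  exact: is_deriveB.
pose psi y := 'D_u (g : V -> R^o) (r + x *: u + y *: v).
have [y ys|y ys Ey] := @mean_value R psi
    (fun y => 'D_v ('D_u (g : V -> R^o)) (r + x *: u + y *: v)) 0 s s0.
  exact: (@is_derive_line R V ('D_u (g : V -> R^o)) (r + x *: u) v y
    (dvu _ (Dxy _ _ xs ys))).
exists x, y; split => //.
move: Ex Ey; rewrite /phi /dphi /psi !scale0r !addr0 !subr0 => Ex Ey.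
rewrite -Ey (addrAC r (x *: u)) -Ex (addrAC r (s *: v)).
by rewrite opprD opprK !addrA.
Qed.

(* Both mixed derivatives, taken at suitable points near [r], equal the same
   second difference quotient. *)
Lemma derive_comm (R : realType) (V : normedModType R) (D : set V)
    (g : V -> R) (u v r : V) :
  open D -> D r ->
  (forall p, D p -> derivable (g : V -> R^o) p u) ->
  (forall p, D p -> derivable (g : V -> R^o) p v) ->
  (forall p, D p -> derivable ('D_u (g : V -> R^o)) p v) ->
  (forall p, D p -> derivable ('D_v (g : V -> R^o)) p u) ->
  {for r, continuous ('D_v ('D_u (g : V -> R^o)))} ->
  {for r, continuous ('D_u ('D_v (g : V -> R^o)))} ->
  'D_v ('D_u (g : V -> R^o)) r = 'D_u ('D_v (g : V -> R^o)) r.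
Proof.
move=> oD Dr du dv duv dvu cuv cvu.
pose A := 'D_v ('D_u (g : V -> R^o)); pose B := 'D_u ('D_v (g : V -> R^o)).
change (A r = B r).
apply/eqP; rewrite -subr_eq0 -normr_le0; apply/ler_addgt0Pr => e e0.
rewrite add0r.
have e2 : 0 < e / 2 by rewrite divr_gt0.
have /nbhs_ballP[d /= d0 rd] : \forall p \near r,
    [/\ D p, `|A r - A p| < e / 2 & `|B r - B p| < e / 2].
  have HD := open_nbhs_nbhs (conj oD Dr).
  have HA : \forall p \near r, `|A r - A p| < e / 2.
    exact: (@cvgrPdist_lt R R^o V _ _ A (A r)).1 cuv _ e2.
  have HB : \forall p \near r, `|B r - B p| < e / 2.
    exact: (@cvgrPdist_lt R R^o V _ _ B (B r)).1 cvu _ e2.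
  by apply: filterS3 HD HA HB => p; split.
(* The summand 1 keeps [M] positive even if [u = v = 0]. The choice of [s] gives [s * M = d / 2], so
   the parallelogram spanned by [s *: u] and [s *: v] at [r] stays in the ball of radius [d]. *)
pose M := `|u| + `|v| + 1.
have M0 : 0 < M by rewrite ltr_wpDl// addr_ge0.
pose s := d / 2 / M.
have s0 : 0 < s by rewrite !divr_gt0.
have Hb x y : 0 <= x <= s -> 0 <= y <= s -> ball r d (r + x *: u + y *: v).
  move=> /andP[x0 xs] /andP[y0 ys].
  rewrite -ball_normE /ball_/= -addrA opprD addNKr normrN.
  apply: (le_lt_trans (ler_normD _ _)); rewrite !normrZ !ger0_norm//.
  apply: (@le_lt_trans _ _ (s * M)); last first.
    by rewrite divfK ?gt_eqF// gtr_pMr// invf_lt1// ltr1n.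
  have := ler_wpM2r (normr_ge0 u) xs; have := ler_wpM2r (normr_ge0 v) ys.
  by rewrite /M; lra.
have Hb' x y : 0 <= x <= s -> 0 <= y <= s -> ball r d (r + x *: v + y *: u).
  by move=> ? ?; rewrite addrAC; exact: Hb.
have [x [y [xs ys E1]]] := @mixed_difference R V D g u v r s (ltW s0) du duv
  (fun x y hx hy => let: And3 h _ _ := rd _ (Hb x y hx hy) in h).
have [x' [y' [xs' ys' E2]]] := @mixed_difference R V D g v u r s (ltW s0) dv dvu
  (fun x y hx hy => let: And3 h _ _ := rd _ (Hb' x y hx hy) in h).
have [_ a1 _] := rd _ (Hb _ _ xs ys).
have [_ _ b1] := rd _ (Hb' _ _ xs' ys').
have AB : A (r + x *: u + y *: v) = B (r + x' *: v + y' *: u).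
  have /mulIf : s != 0 by rewrite gt_eqF.
  move=> inj; apply: (inj); apply: (inj); apply: (etrans (esym E1)).
  apply: etrans E2; rewrite (addrAC r (s *: v)); congr (_ + _); exact: addrAC.
exact: ler_dist_common_point a1 b1 AB.
Qed.

(** * Boxes, and moving one coordinate at a time *)

Lemma open_box (R : realType) (N : nat) (I : 'I_N -> set R) :
  (forall i, open (I i)) -> open (box I).
Proof.
move=> oI; rewrite openE => r Ir; 
apply: (@filter_forall 'rV[R]_N 'I_N (fun i p => I i (p 0 i)) (nbhs r) _).
move=> i.
by apply: coord_continuous; apply: open_nbhs_nbhs; split => //; exact: Ir.
Qed.

Section update_coordinate.
Variables (R : realType) (N : nat).
Implicit Types (r p : 'rV[R]_N) (i j : 'I_N).

(** Written as an affine line in [s] with direction [dir i], so that the derivative along a line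
    applies to it as is. *)
Definition upd r i (s : R) : 'rV[R]_N := (r - r 0 i *: dir i) + s *: dir i.

Lemma updE r i s j : upd r i s 0 j = if j == i then s else r 0 j.
Proof.
rewrite /upd /dir !mxE eqxx /= eq_sym; case: eqVneq => [->|_] /=.
  by rewrite !mulr1 subrr add0r.
by rewrite !mulr0 subr0 addr0.
Qed.

Lemma upd_id r i : upd r i (r 0 i) = r.
Proof. by rewrite /upd subrK. Qed.

Lemma box_upd (I : 'I_N -> set R) r i s : box I r -> I i s -> box I (upd r i s).
Proof. by move=> Ir Is j; rewrite updE; case: eqVneq => [->|_]. Qed.

Lemma upd_continuous r i : continuous (upd r i).
Proof.
move=> s; rewrite /upd; apply: cvgD; first exact: cvg_cst.
exact: scalel_continuous.
Qed.

Lemma is_derive_upd (g : 'rV[R]_N -> R) r i s :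
  derivable (g : 'rV[R]_N -> R^o) (upd r i s) (dir i) ->
  is_derive s (1 : R) (fun t => g (upd r i t) : R^o) (partial i g (upd r i s)).
Proof. exact: is_derive_line. Qed.

End update_coordinate.

(* Pass from [r] to [r'] by replacing one coordinate at a time. *)
Lemma box_lipschitz (R : realType) (N : nat) (I : 'I_N -> set R)
    (g : 'rV[R]_N -> R) (M : R) (r r' : 'rV[R]_N) :
  (forall i, is_interval (I i)) -> box I r -> box I r' ->
  (forall i p, r 0 i != r' 0 i -> box I p ->
     derivable (g : 'rV[R]_N -> R^o) p (dir i) /\ `|partial i g p| <= M) ->
  `|g r' - g r| <= \sum_(i < N) M * `|r' 0 i - r 0 i|.
Proof.
move=> Iitv Ir Ir' dg.
pose w n := \row_j (if (j < n)%N then r' 0 j else r 0 j).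
have Iw n : box I (w n) by move=> j; rewrite mxE; case: ifP.
have -> : r' = w N by apply/rowP => j; rewrite mxE ltn_ord.
have -> : r = w 0 by apply/rowP => j; rewrite mxE.
rewrite -(telescope_sumr (fun n => g (w n)))// big_mkord.
apply: (le_trans (ler_norm_sum _ _ _)); apply: ler_sum => i _.
have -> : w i.+1 = upd (w i) i (r' 0 i).
  apply/rowP => j; rewrite updE !mxE ltnS; case: eqVneq => [->|ji].
    by rewrite leqnn.
  rewrite leq_eqVlt -[(_ == _)%N]/(val j == val i) (inj_eq val_inj).
  by rewrite (negbTE ji).
have wi : w i 0 i = r 0 i by rewrite mxE ltnn.
have -> : w N 0 i = r' 0 i by rewrite mxE ltn_ord.
have -> : w 0 0 i = r 0 i by rewrite mxE.
have E : w i = upd (w i) i (r 0 i) by rewrite -wi upd_id.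
suff : `|g (upd (w i) i (r' 0 i)) - g (upd (w i) i (r 0 i))|
    <= M * `|r' 0 i - r 0 i| by rewrite -E.
(* The bound on the derivative is available only in directions where the end points differ; in the
   others this step of the path does not move. *)
have [rr'|rr'] := eqVneq (r 0 i) (r' 0 i).
  by rewrite rr' !subrr normr0 mulr0.
apply: (@itv_lipschitz R (I i) (fun s => g (upd (w i) i s))
  (fun s => partial i g (upd (w i) i s))) => //= s Is;
  have [gd gM] := dg i (upd (w i) i s) rr' (box_upd (Iw i) Is) => //.
exact: is_derive_upd.
Qed.

(** The Lipschitz bound with constant 0. Points that share a coordinate can be compared without any
    information on the derivative in that direction. *)
Lemma box_eq_of_partial0 (R : realType) (N : nat) (I : 'I_N -> set R)
    (g : 'rV[R]_N -> R) (r r' : 'rV[R]_N) :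
  (forall i, is_interval (I i)) -> box I r -> box I r' ->
  (forall i p, r 0 i != r' 0 i -> box I p ->
     derivable (g : 'rV[R]_N -> R^o) p (dir i) /\ partial i g p = 0) ->
  g r = g r'.
Proof.
move=> Iitv Ir Ir' dg; have := @box_lipschitz R N I g 0 r r' Iitv Ir Ir'.
rewrite big1 => [H|i _]; last by rewrite mul0r.
apply/eqP; rewrite eq_sym -subr_eq0 -normr_le0; apply: H => i p ri Ip.
by have [? ->] := dg i p ri Ip; rewrite normr0.
Qed.

(* [Cn_on D 2] does not ask for continuity of the first derivatives; it follows
   from that of the second ones. *)
Lemma continuous_of_partial (R : realType) (N : nat) (D : set 'rV[R]_N)
    (g : 'rV[R]_N -> R) (r : 'rV[R]_N) :
  open D -> D r ->
  (forall i p, D p -> derivable (g : 'rV[R]_N -> R^o) p (dir i)) ->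
  (forall i, {for r, continuous (partial i g)}) ->
  {for r, continuous g}.
Proof.
move=> oD Dr dg cg.
(* Near [r] each first derivative is within 1 of its value at [r], so [M] bounds them all at
   once. *)
pose M := \sum_(i < N) `|partial i g r| + 1.
have M1 : 1 <= M by rewrite lerDr sumr_ge0.
have : \forall p \near r, D p /\ forall i, `|partial i g p| <= M.
  have HM : \forall p \near r, forall i, `|partial i g p| <= M.
    apply: (@filter_forall 'rV[R]_N 'I_N (fun i p => `|partial i g p| <= M)
      (nbhs r) _) => i.
    have : \forall p \near r, `|partial i g r - partial i g p| < 1.
      exact: (@cvgrPdist_lt R R^o _ _ _ (partial i g) (partial i g r)).1
        (cg i) _ ltr01.
    apply: filterS => p rp; rewrite /M (bigD1 i)//= -addrA.
    have := lerB_dist (partial i g p) (partial i g r).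
    rewrite lerBlDl => /le_trans; apply; rewrite lerD2l distrC.
    by rewrite (le_trans (ltW rp))// lerDr sumr_ge0.
  by apply: filterS2 (open_nbhs_nbhs (conj oD Dr)) HM.
move=> /nbhs_ballP[d /= d0 rd].
(* A ball of the matrix norm is a product of intervals, so the Lipschitz bound for boxes applies
   inside it. *)
have Iitv (i : 'I_N) : is_interval (ball (r 0 i) d).
  move=> x y; rewrite -ball_normE /ball_/= => rx ry z /andP[xz zy].
  by rewrite ltr_norml; move: rx ry; rewrite !ltr_norml; lra.
have Ib p : box (fun i => ball (r 0 i) d) p -> ball r d p.
  by move=> H; split => // i j; rewrite (ord1 i); exact: H.
have Irr : box (fun i => ball (r 0 i) d) r by move=> i; exact: ballxx.
apply: (@cvgrPdist_lt R R^o _ (nbhs r) _ g (g r)).2 => e e0.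
(* The [N] summands are at most [M * b] each, for a total of e N / (N + 1), strictly below [e]. *)
pose b := e / (M * N.+1%:R).
have b0 : 0 < b by rewrite divr_gt0// mulr_gt0// (lt_le_trans ltr01).
have : nbhs r (ball r (Num.min b d)) by apply: nbhsx_ballx; rewrite lt_min b0.
apply: filterS => p [_ rp].
have rpi i : `|r 0 i - p 0 i| < b /\ `|r 0 i - p 0 i| < d.
  by have := rp 0 i; rewrite -ball_normE /ball_/= lt_min => /andP.
have Ip : box (fun i => ball (r 0 i) d) p.
  by move=> i; rewrite -ball_normE /ball_/=; have [] := rpi i.
rewrite distrC.
apply: le_lt_trans (@box_lipschitz R N _ g M r p Iitv Irr Ip _) _.
  by move=> i q _ /Ib /rd[Dq qM]; split; [exact: dg|exact: qM].
apply: (@le_lt_trans _ _ (\sum_(i < N) M * b)).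
  apply: ler_sum => i _; rewrite ler_wpM2l ?(le_trans ler01)// distrC ltW//.
  by have [] := rpi i.
rewrite sumr_const card_ord -mulr_natr mulrAC /b mulrCA gtr_pMr//.
rewrite ltr_pdivrMr ?mul1r ?ltr_pM2l ?ltr_nat//.
  by rewrite (lt_le_trans ltr01).
by rewrite mulr_gt0// (lt_le_trans ltr01).
Qed.

(** * Local properties of functions on open sets *)

Lemma eq_on_partial (R : realType) (N : nat) (D : set 'rV[R]_N)
    (g h : 'rV[R]_N -> R) (i : 'I_N) (r : 'rV[R]_N) :
  open D -> D r -> (forall p, D p -> g p = h p) ->
  partial i g r = partial i h r.
Proof.
move=> oD Dr gh; apply: near_eq_derive.
by apply: filterS (open_nbhs_nbhs (conj oD Dr)) => p /gh.
Qed.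

Lemma eq_on_derivable (R : realType) (N : nat) (D : set 'rV[R]_N)
    (g h : 'rV[R]_N -> R) (i : 'I_N) (r : 'rV[R]_N) :
  open D -> D r -> (forall p, D p -> g p = h p) ->
  derivable (g : 'rV[R]_N -> R^o) r (dir i) ->
  derivable (h : 'rV[R]_N -> R^o) r (dir i).
Proof.
move=> oD Dr gh; apply: near_eq_derivable.
by apply: filterS (open_nbhs_nbhs (conj oD Dr)) => p /gh.
Qed.

Lemma eq_on_continuous (R : realType) (N : nat) (D : set 'rV[R]_N)
    (g h : 'rV[R]_N -> R) (r : 'rV[R]_N) :
  open D -> D r -> (forall p, D p -> g p = h p) ->
  {for r, continuous g} -> {for r, continuous h}.
Proof.
move=> oD Dr gh cg.
suff : h @ r --> g r by rewrite (gh _ Dr).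
have gh_r : \forall p \near r, g p = h p.
  by apply: filterS (open_nbhs_nbhs (conj oD Dr)) => p /gh.
by apply: cvg_trans cg; exact: near_eq_cvg gh_r.
Qed.

Lemma partial_comm (R : realType) (N : nat) (D : set 'rV[R]_N)
    (g : 'rV[R]_N -> R) (i j : 'I_N) (r : 'rV[R]_N) :
  open D -> D r -> Cn_on D 2 g ->
  partial j (partial i g) r = partial i (partial j g) r.
Proof.
move=> oD Dr /C2_derivable[d1 d2 c2].
apply: (@derive_comm _ _ D) => //.
- by move=> p; exact: d1.
- by move=> p; exact: d1.
- by move=> p; exact: d2.
- by move=> p; exact: d2.
- exact: c2.
- exact: c2.
Qed.

(** If [h r] were nonzero, [h] would be nonzero on a neighbourhood of [r], which meets [A]. *)
Lemma eq0_of_dense (R : realType) (T : topologicalType) (D A : set T)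
    (h : T -> R) :
  (forall r, D r -> {for r, continuous h}) -> D `<=` closure A ->
  (forall r, A r -> h r = 0) -> forall r, D r -> h r = 0.
Proof.
move=> ch DA hA r Dr; apply/eqP/negPn/negP => hr.
have : nbhs r (h @^-1` [set y | y != 0]).
  by apply: ch => //; apply: open_nbhs_nbhs; split => //; exact: open_neq.
by move=> /(DA _ Dr)[p [/hA hp]] /=; rewrite hp eqxx.
Qed.

(** * Compatibility conditions of the chain *)

Lemma partial_mul (R : realType) (N : nat) (g h : 'rV[R]_N -> R) (i : 'I_N)
    (r : 'rV[R]_N) :
  derivable (g : 'rV[R]_N -> R^o) r (dir i) ->
  derivable (h : 'rV[R]_N -> R^o) r (dir i) ->
  partial i (fun p => g p * h p) r = partial i g r * h r + g r * partial i h r.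
Proof.
move=> dg dh; rewrite /partial (deriveM dg dh) addrC mulrC; congr (_ + _).
Qed.

(* The roles of the variables: [wi = W_i], [x = d_j W_i], [a = d_i c_k],
   [m = d_i d_j c_k], [m' = d_i d_j c_{k+1}], and symmetrically [wj], [y],
   [b]. *)
Lemma mixed_sum_eq0 (R : idomainType) (wi wj x y a b m m' : R) :
  wi != wj ->
  m' = x * a + wi * m -> m' = y * b + wj * m ->
  x * (wi * a) + wi * m' = y * (wj * b) + wj * m' ->
  y * b + x * a = 0.
Proof.
move=> wij E1 E2 E3; have : (wi - wj) * (y * b + x * a) = 0.
  transitivity ((x * (wi * a) + wi * (y * b + wj * m))
                - (y * (wj * b) + wj * (x * a + wi * m))); first by ring.
  by rewrite -E1 -E2 E3 subrr.
by move=> /eqP; rewrite mulf_eq0 subr_eq0 (negbTE wij) => /eqP.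
Qed.

(** With the same reading of the variables: the two expressions for [m'] reduce to [wi * m] and
    [wj * m]. *)
Lemma mixed_eq0 (R : idomainType) (wi wj x y a b m m' : R) :
  wi != wj -> m' = x * a + wi * m -> m' = y * b + wj * m ->
  x = 0 -> y = 0 -> m = 0.
Proof.
move=> wij -> + x0 y0; rewrite x0 y0 !mul0r !add0r => /eqP.
by rewrite -subr_eq0 -mulrBl mulf_eq0 subr_eq0 (negbTE wij) => /eqP.
Qed.

Section chain.
Variables (R : realType) (N : nat) (D : set 'rV[R]_N).
Variables (W : 'I_N -> 'rV[R]_N -> R) (c : int -> 'rV[R]_N -> R).
Hypothesis D_open : open D.
Hypothesis W_derivable : forall i j r, D r ->
  derivable (W i : 'rV[R]_N -> R^o) r (dir j).
Hypothesis W_distinct : forall i j r, D r -> i != j -> W i r != W j r.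
Hypothesis c_C2 : forall k, Cn_on D 2 (c k).
Hypothesis chain : forall k i r, D r ->
  partial i (c (k + 1)) r = W i r * partial i (c k) r.

Lemma chain_mixed k i j r : D r ->
  partial j (partial i (c (k + 1))) r =
  partial j (W i) r * partial i (c k) r + W i r * partial j (partial i (c k)) r.
Proof.
move=> Dr; rewrite -partial_mul; last 2 first.
- exact: W_derivable.
- by have [_ + _] := C2_derivable (c_C2 k); apply.
by apply: (eq_on_partial j D_open Dr) => p; exact: chain.
Qed.

Lemma chain_comm n i j r : D r ->
  partial i (partial j (c n)) r = partial j (partial i (c n)) r.
Proof. by move=> Dr; exact: partial_comm (c_C2 n). Qed.

(** The mixed derivatives of the moments of index k + 1 and k + 2 are each expanded in two ways;
    eliminating them leaves the sum multiplied by W_i - W_j. *)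
Lemma chain_sum0 k i j r : D r -> i != j ->
  partial i (W j) r * partial j (c k) r + partial j (W i) r * partial i (c k) r
  = 0.
Proof.
move=> Dr ij.
have E1 := chain_mixed k i j Dr; have E2 := chain_mixed k j i Dr.
have E3 := chain_mixed (k + 1) i j Dr; have E4 := chain_mixed (k + 1) j i Dr.
rewrite !(chain_comm _ i j Dr) in E2 E4; rewrite E4 in E3.
rewrite (chain k i Dr) (chain k j Dr) in E3.
exact: mixed_sum_eq0 (W_distinct Dr ij) E1 E2 (esym E3).
Qed.

(** The relations at [k] and [k + 1] form a homogeneous linear system in the two summands, with
    determinant W_j - W_i. *)
Lemma chain_shift_partial k i j r : D r -> i != j ->
  partial j (W i) r * partial i (c k) r = 0.
Proof.
move=> Dr ij; have /eqP := chain_sum0 (k + 1) Dr ij.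
have /eqP := chain_sum0 k Dr ij; rewrite addr_eq0 => /eqP E.
rewrite (chain k i Dr) (chain k j Dr) mulrCA E mulrN.
rewrite [X in _ + X]mulrCA addrC -mulrBl mulf_eq0.
by rewrite subr_eq0 (negbTE (W_distinct Dr ij)) => /eqP.
Qed.

Lemma chain_mixed0 k i j r : D r -> i != j ->
  partial j (W i) r = 0 -> partial i (W j) r = 0 ->
  partial j (partial i (c k)) r = 0.
Proof.
move=> Dr ij Wi Wj.
have E1 := chain_mixed k i j Dr; have E2 := chain_mixed k j i Dr.
rewrite !(chain_comm _ i j Dr) in E2.
exact: mixed_eq0 (W_distinct Dr ij) E1 E2 Wi Wj.
Qed.

End chain.

(** * Separation of variables on a box *)

Lemma is_derive_coord (R : realType) (N : nat) (h : R -> R) (p : 'rV[R]_N)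
    (i m : 'I_N) (d : R) :
  is_derive (p 0 m) (1 : R) (h : R -> R^o) d ->
  is_derive p (dir i) (fun q : 'rV[R]_N => h (q 0 m) : R^o)
    (if i == m then d else 0).
Proof.
case=> dh hd; case: eqVneq => [->{i}|im].
  have E : (fun s : R => s^-1 *: ((h ((s *: dir m + p) 0 m) : R^o) - h (p 0 m)))
     = (fun s : R => s^-1 *: ((h (s *: (1 : R) + p 0 m) : R^o) - h (p 0 m))).
    apply/funext => s; congr (_ *: (h _ - _)).
    by rewrite !mxE !eqxx.
  apply: DeriveDef; last by rewrite -hd /derive /= E.
  by rewrite /derivable /= E.
have E : (fun s : R => s^-1 *: ((h ((s *: dir i + p) 0 m) : R^o) - h (p 0 m)))
     = (fun s : R => 0).
  apply/funext => s; rewrite !mxE eqxx eq_sym (negbTE im) mulr0 add0r subrr.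
  exact: scaler0.
apply: DeriveDef; last by rewrite /derive /= E; exact: lim_cst.
by rewrite /derivable /= E; exact: is_cvg_cst.
Qed.

Section separation.
Variables (R : realType) (N : nat) (I : 'I_N -> set R).
Hypothesis I_itv : forall i, is_interval (I i).

(** The two points share their [i]-th coordinate, so only the derivatives that vanish enter the
    comparison. *)
Lemma box_depends_on_one (W : 'rV[R]_N -> R) (i : 'I_N) (r0 r : 'rV[R]_N) :
  box I r0 -> box I r ->
  (forall j p, box I p -> i != j ->
     derivable (W : 'rV[R]_N -> R^o) p (dir j) /\ partial j W p = 0) ->
  W r = W (upd r0 i (r 0 i)).
Proof.
move=> Ir0 Ir dW; apply: (box_eq_of_partial0 I_itv) => //; first exact: box_upd.
move=> j p; rewrite updE; case: (eqVneq j i) => [->|ji _ Ip].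
  by rewrite eqxx.
by apply: dW; rewrite // eq_sym.
Qed.

(** Subtract from [g] its restrictions to the coordinate lines through [r0]. As d_i g depends on r^i
    alone, it agrees with the derivative of the [i]-th restriction, so the difference [h] is
    constant. *)
Lemma box_additive (g : 'rV[R]_N -> R) (r0 r : 'rV[R]_N) :
  Cn_on (box I) 2 g ->
  (forall i j p, box I p -> i != j -> partial j (partial i g) p = 0) ->
  box I r0 -> box I r ->
  g r = g r0 + \sum_(m < N) (g (upd r0 m (r 0 m)) - g r0).
Proof.
move=> g2 gij Ir0 Ir; have [dg d2g _] := C2_derivable g2.
pose h (p : 'rV[R]_N) := g p - \sum_(m < N) g (upd r0 m (p 0 m)).
have : h r = h r0.
  apply: (box_eq_of_partial0 I_itv) => // i p _ Ip.
  have gi : partial i g p = partial i g (upd r0 i (p 0 i)).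
    by apply: box_depends_on_one => // j q Iq ij; split; [exact: d2g|exact: gij].
  have Dg := derivableP (dg i p Ip).
  have Dm (m : 'I_N) := is_derive_coord i
    (is_derive_upd (dg m _ (box_upd Ir0 (Ip m)))).
  have hE : (h : 'rV[R]_N -> R^o) =
      (g : 'rV[R]_N -> R^o) -
      \sum_(m < N) (fun q : 'rV[R]_N => g (upd r0 m (q 0 m)) : R^o).
    by apply/funext => q; rewrite fctE fct_sumE.
  have [] : is_derive p (dir i) (h : 'rV[R]_N -> R^o) (partial i g p -
      \sum_(m < N) (if i == m then partial m g (upd r0 m (p 0 m)) else 0)).
    by rewrite hE; exact: is_deriveB Dg (is_derive_sum Dm).
  move=> ? Eh; split=> //; apply: (etrans Eh).
  rewrite (bigD1 i)//= eqxx big1 => [|m /negbTE]; last first.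
    by rewrite eq_sym => ->.
  by rewrite addr0 -gi subrr.
rewrite /h [X in _ = _ - X](eq_bigr (fun=> g r0)) => [E|m _]; last first.
  by rewrite upd_id.
by rewrite big_split/= sumrN addrCA -E addrC subrK.
Qed.

End separation.

(** * From the embedding to the separated form *)

Lemma embedded_separated (R : realType) (N : nat) (I : 'I_N -> set R)
    (I_open : forall i, open (I i)) (I_itv : forall i, is_interval (I i))
    (V : 'I_N -> 'rV[R]_N -> R)
    (V_C1 : forall i, Cn_on (box I) 1 (V i))
    (V_distinct : forall i k, i != k -> forall r, box I r -> V i r != V k r)
    (c1 : 'rV[R]_N -> R) (c1_C2 : Cn_on (box I) 2 c1) :
  (0 < N)%N -> depends_on_all (box I) c1 ->
  embedded_with_first_moment (box I) V c1 -> separated_form (box I) V c1.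
Proof.
move=> N_gt0 dep [c [[cC2 cV] cc1]].
(* A base point is needed to define [f] and [psi]; on an empty box any functions will do. *)
have [[r0 Ir0]|noI] := pselect (exists r, box I r); last first.
  exists (fun _ _ => 0), (fun _ _ => 0); split=> [i r Ir|r Ir];
    by case: noI; exists r.
have oD := open_box I_open.
have [dc1 d2c1 c2c1] := C2_derivable c1_C2.
pose W i p := V i p + c1 p.
have Wd i j r : box I r -> derivable (W i : 'rV[R]_N -> R^o) r (dir j).
  by move=> Ir; apply: derivableD; [have [+ _] := V_C1 i; apply|exact: dc1].
have Wdist i j r : box I r -> i != j -> W i r != W j r.
  by move=> Ir ij; rewrite (inj_eq (addIr _)) V_distinct.
have Wchain k i r : box I r ->
    partial i (c (k + 1)) r = W i r * partial i (c k) r.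
  by move=> Ir; rewrite /W mulrDl (cV k i r Ir) cc1// subrK.
have Wc i j r : box I r -> {for r, continuous (partial j (W i))}.
  move=> Ir; have [dV cVi] := V_C1 i.
  have pW p : box I p -> partial j (V i) p + partial j c1 p = partial j (W i) p.
    by move=> Ip; apply/esym; apply: deriveD; [exact: dV|exact: dc1].
  apply: (eq_on_continuous oD Ir pW).
  have cVr : {for r, continuous (partial j (V i))} := cVi j r Ir.
  have cc1r : {for r, continuous (partial j c1)}.
    apply: (continuous_of_partial oD Ir) => [k p|k]; first exact: d2c1.
    exact: c2c1.
  exact: cvgD cVr cc1r.
(* The chain at [k = 1] gives this where d_i c_1 is nonzero; continuity and density extend it to the
   box. *)
have W0 i j r : box I r -> i != j -> partial j (W i) r = 0.
  move=> Ir ij; apply: (eq0_of_dense _ (dep i)) Ir; first exact: Wc.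
  move=> p [Ip /negbTE c1p].
  have /eqP := chain_shift_partial oD Wd Wdist cC2 Wchain 1 Ip ij.
  by rewrite mulf_eq0 (eq_on_partial i oD Ip cc1) c1p orbF => /eqP.
have c1ij i j r : box I r -> i != j -> partial j (partial i c1) r = 0.
  move=> Ir ij; rewrite -(chain_mixed0 oD Wd Wdist cC2 Wchain 1 Ir ij).
  - apply: (eq_on_partial _ oD Ir) => p Ip.
    apply: (eq_on_partial _ oD Ip) => s Is.
    by rewrite cc1.
  - exact: W0.
  - by apply: W0; rewrite // eq_sym.
(* Both families are read off on the coordinate lines through [r0]. The constant [c1 r0] left over
   by the additive decomposition is absorbed into the first [psi], which exists because [N] is
   positive. *)
exists (fun i s => W i (upd r0 i s)), (fun m s =>
  c1 (upd r0 m s) - c1 r0 + (if m == Ordinal N_gt0 then c1 r0 else 0)).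
split=> [i r Ir|r Ir].
  rewrite -(@box_depends_on_one R N I I_itv (W i) i r0 r)//.
    by rewrite addrK.
  by move=> j p Ip ij; split; [exact: Wd|exact: W0].
rewrite {1}(box_additive I_itv c1_C2 c1ij Ir0 Ir) [RHS]big_split/= addrC.
by rewrite -big_mkcond big_pred1_eq.
Qed.

(** * Regularity of functions of one variable and of their lifts to a box *)

Definition C1_on (R : realType) (J : set R) (h : R -> R) : Prop :=
  exists2 dh : R -> R,
    (forall x, J x -> is_derive x (1 : R) (h : R -> R^o) (dh x)) &
    (forall x, J x -> {for x, continuous dh}).

Section C1_on.
Variables (R : realType) (J : set R).

Lemma C1_on_continuous (h : R -> R) x :
  C1_on J h -> J x -> {for x, continuous h}.
Proof. by case=> dh hd _ Jx; exact: is_derive_continuous (hd _ Jx). Qed.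

Lemma C1_onM (g h : R -> R) : C1_on J g -> C1_on J h ->
  C1_on J (fun x => g x * h x).
Proof.
move=> g1 h1; have [dg gd gc] := g1; have [dh hd hc] := h1.
exists (fun x => g x * dh x + h x * dg x) => x Jx.
  have := gd x Jx; have := hd x Jx => Dh Dg.
  exact: (is_deriveM Dg Dh).
by apply: cvgD; apply: cvgM; (exact: C1_on_continuous || exact: gc || exact: hc).
Qed.

Lemma C1_onV (h : R -> R) : (forall x, J x -> h x != 0) -> C1_on J h ->
  C1_on J (fun x => (h x)^-1).
Proof.
move=> h0 h1; have [dh hd hc] := h1.
exists (fun x => - (h x) ^- 2 * dh x) => x Jx.
  exact: (is_deriveV (h0 _ Jx) (hd _ Jx)).
have ch := C1_on_continuous h1 Jx.
apply: cvgM; last exact: hc.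
apply: cvgN; apply: cvgV; first by rewrite expf_neq0// h0.
by rewrite expr2; under eq_cvg do rewrite expr2; exact: cvgM.
Qed.

Lemma C1_onX (h : R -> R) n : C1_on J h -> C1_on J (fun x => h x ^+ n).
Proof.
move=> h1; elim: n => [|n IHn].
  exists (cst 0) => x _; last exact: cst_continuous.
  exact: is_derive_cst.
under eq_fun do rewrite exprS.
exact: C1_onM.
Qed.

Lemma C1_on_exprz (h : R -> R) (k : int) : (forall x, J x -> h x != 0) ->
  C1_on J h -> C1_on J (fun x => h x ^ k).
Proof.
move=> h0 h1; case: k => n; first exact: C1_onX.
apply: C1_onV; last exact: C1_onX.
by move=> x Jx; rewrite expf_neq0// h0.
Qed.

End C1_on.

(** The second derivatives of [g] are those of [h i] on the diagonal and 0 off it, hence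
    continuous. *)
Lemma Cn_on2_coord (R : realType) (N : nat) (I : 'I_N -> set R)
    (g : 'rV[R]_N -> R) (h : 'I_N -> R -> R) :
  (forall i, open (I i)) -> (forall i, C1_on (I i) (h i)) ->
  (forall i r, box I r -> derivable (g : 'rV[R]_N -> R^o) r (dir i)) ->
  (forall i r, box I r -> partial i g r = h i (r 0 i)) ->
  Cn_on (box I) 2 g.
Proof.
move=> oI h1 dg gh; have oD := open_box oI; split => // i.
have [dh hd hc] := h1 i.
have Dh j r : box I r -> is_derive r (dir j)
    (fun q : 'rV[R]_N => h i (q 0 i) : R^o) (if j == i then dh (r 0 i) else 0).
  by move=> Ir; apply: is_derive_coord; exact: hd.
have ghE p : box I p -> h i (p 0 i) = partial i g p by move=> ?; rewrite gh.
split=> j r Ir.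
  by apply: (eq_on_derivable oD Ir ghE); have [] := Dh j r Ir.
have pE p : box I p -> (if j == i then dh (p 0 i) else 0) = partial j (partial i g) p.
  move=> Ip; rewrite -(eq_on_partial j oD Ip ghE).
  by have [_ <-] := Dh j p Ip.
apply: (eq_on_continuous oD Ir pE); case: eqVneq => _; last exact: cst_continuous.
apply: (@continuous_comp _ _ _ (fun q : 'rV[R]_N => q 0 i) dh).
  exact: coord_continuous.
exact: hc.
Qed.

(** * Primitives and potentials *)

(** Since [S u v] is 0 for [v <= u], the difference [S a y - S y a] is the oriented integral from a
    base point [a] to [y], on either side of [a]. *)
Lemma exists_primitive (R : realType) (J : set R) (h : R -> R) :
  open J -> is_interval J -> (forall x, J x -> {for x, continuous h}) ->
  exists G : R -> R, forall x, J x -> is_derive x (1 : R) (G : R -> R^o) (h x).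
Proof.
move=> oJ Jitv ch.
have [[a Ja]|noJ] := pselect (exists a, J a); last first.
  by exists h => x Jx; case: noJ; exists x.
have hint u v : J u -> J v -> lebesgue_measure.-integrable `[u, v] (EFin \o h).
  move=> Ju Jv; apply: continuous_compact_integrable; first exact: segment_compact.
  apply/continuous_in_subspaceT => x /[!inE]/= /[!in_itv]/= xuv.
  exact/ch/(Jitv _ _ Ju Jv).
pose S u v := \int[lebesgue_measure]_(t in `[u, v]) h t.
have S0 u v : v <= u -> S u v = 0.
  rewrite le_eqVlt => /predU1P[->|vu]; first by rewrite /S set_itv1 Rintegral_set1.
  by rewrite /S set_itv_ge ?Rintegral_set0// bnd_simp -ltNge.
have SB u v w : J u -> J w -> u <= v -> v <= w -> S u w - S u v = S v w.
  move=> Ju Jw uv vw; have Jv : J v by apply: (Jitv _ _ Ju Jw); rewrite uv.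
  rewrite /S Rintegral_itvB ?bnd_simp//; last exact: hint.
  rewrite Rintegral_itv_obnd_cbnd//.
  by apply: integrableS (hint _ _ Jv Jw) => //; exact: subset_itv_oc_cc.
exists (fun y => S a y - S y a) => x Jx.
(* With a lower limit [b] to the left of both [x] and [a], the primitive equals [S b y - S b a] for
   [y] near [x], and the fundamental theorem applies to [S b]. *)
have [b Jb [bx ba]] : exists2 b, J b & b < x /\ b < a.
  pose m := Num.min x a.
  have Jm : J m by rewrite /m /Num.min; case: ifP.
  have /nbhs_ballP[d /= d0 md] := open_nbhs_nbhs (conj oJ Jm).
  have d2 : 0 < d / 2 by rewrite divr_gt0.
  exists (m - d / 2).
    by apply: md; rewrite -ball_normE /ball_/= subKr gtr0_norm//
      gtr_pMr// invf_lt1// ltr1n.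
  by split; rewrite ltrBlDr; apply: ltr_pwDr; rewrite // /m ge_min lexx ?orbT.
have [u Ju xu] : exists2 u, J u & x < u.
  have /nbhs_ballP[d /= d0 xd] := open_nbhs_nbhs (conj oJ Jx).
  have d2 : 0 < d / 2 by rewrite divr_gt0.
  exists (x + d / 2); last by rewrite ltrDl.
  apply: xd; rewrite -ball_normE /ball_/= opprD addNKr normrN gtr0_norm//.
  by rewrite gtr_pMr// invf_lt1// ltr1n.
have [dF hF] := continuous_FTC1_closed xu (hint _ _ Jb Ju) bx (ch _ Jx).
have DF : is_derive x (1 : R) (S b : R -> R^o) (h x).
  by apply: DeriveDef dF _; rewrite -derive1E.
have DFc := is_deriveB DF (is_derive_cst (S b a : R^o) x (1 : R)).
rewrite subr0 in DFc; apply: near_eq_is_derive DFc.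
have : \forall y \near x, J y /\ b < y.
  by apply: filterS2 (open_nbhs_nbhs (conj oJ Jx)) (lt_nbhsr bx).
apply: filterS => y [Jy byy]; rewrite fctE /=.
have [ay|/ltW ya] := leP a y.
  by rewrite (S0 y a)// subr0 SB// ltW.
by rewrite (S0 a y)// sub0r -(SB b y a)// ?opprB// ltW.
Qed.

Lemma exists_coord_potential (R : realType) (N : nat) (I : 'I_N -> set R)
    (h : 'I_N -> R -> R) :
  (forall i, open (I i)) -> (forall i, is_interval (I i)) ->
  (forall i x, I i x -> {for x, continuous (h i)}) ->
  exists g : 'rV[R]_N -> R, forall i r, box I r ->
    derivable (g : 'rV[R]_N -> R^o) r (dir i) /\ partial i g r = h i (r 0 i).
Proof.
move=> oI Iitv ch.
have [G hG] := choice (fun i => exists_primitive (oI i) (Iitv i) (ch i)).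
exists (\sum_(m < N) (fun q : 'rV[R]_N => G m (q 0 m) : R^o)) => i r Ir.
have Dm (m : 'I_N) := is_derive_coord i (hG m _ (Ir m)).
have [dS ES] := is_derive_sum Dm; split => //.
apply: (etrans ES); rewrite (bigD1 i)//= eqxx big1 ?addr0// => m.
by rewrite eq_sym => /negbTE ->.
Qed.

(** * From the separated form to the moments *)

Lemma separated_embedded (R : realType) (N : nat) (I : 'I_N -> set R)
    (I_open : forall i, open (I i)) (I_itv : forall i, is_interval (I i))
    (V : 'I_N -> 'rV[R]_N -> R)
    (V_C1 : forall i, Cn_on (box I) 1 (V i))
    (c1 : 'rV[R]_N -> R) (c1_C2 : Cn_on (box I) 2 c1) :
  nonvanishing_shift (box I) V c1 ->
  separated_form (box I) V c1 -> embedded_with_first_moment (box I) V c1.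
Proof.
move=> nv [f [psi [Vf c1psi]]].
have oD := open_box I_open.
have [dc1 d2c1 c2c1] := C2_derivable c1_C2.
have [[r0 Ir0]|noI] := pselect (exists r, box I r); last first.
  exists (fun _ => c1); split=> //; split=> // k i r Ir.
  by case: noI; exists r.
(* [f] and [psi] carry no regularity, so f_i and psi_i' are replaced by V_i + c_1 and d_i c_1 on the
   coordinate line through [r0], which are of class C^1. *)
pose F i s := V i (upd r0 i s) + c1 (upd r0 i s).
pose q i s := partial i c1 (upd r0 i s).
have FE i r : box I r -> F i (r 0 i) = V i r + c1 r.
  move=> Ir; have Iu : box I (upd r0 i (r 0 i)) by exact: box_upd.
  by rewrite /F !Vf// updE eqxx !subrK.
have F0 i s : I i s -> F i s != 0 by move=> Is; apply: nv; exact: box_upd.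
have F1 i : C1_on (I i) (F i).
  have [dV cV] := V_C1 i.
  exists (fun s => partial i (V i) (upd r0 i s) + partial i c1 (upd r0 i s)) => s Is;
    have Iu := box_upd Ir0 Is.
    exact: is_deriveD (is_derive_upd (dV i _ Iu)) (is_derive_upd (dc1 i _ Iu)).
  have cVi : {for upd r0 i s, continuous (partial i (V i))} := cV i _ Iu.
  have cc1i : {for upd r0 i s, continuous (partial i c1)}.
    by apply: (continuous_of_partial oD Iu) => [k p|k]; [exact: d2c1|exact: c2c1].
  have cu := @upd_continuous R N r0 i s.
  exact: cvgD (continuous_comp cu cVi) (continuous_comp cu cc1i).
have q1 i : C1_on (I i) (q i).
  exists (fun s => partial i (partial i c1) (upd r0 i s)) => s Is;
    have Iu := box_upd Ir0 Is.
    exact: is_derive_upd (d2c1 i i _ Iu).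
  exact: continuous_comp (@upd_continuous R N r0 i s) (c2c1 i i _ Iu).
have c1q i r : box I r -> partial i c1 r = q i (r 0 i).
  move=> Ir; have Iu0 : box I (upd r0 i (r 0 i)) by exact: box_upd.
  have Iu : box I (upd r i (r 0 i)) by exact: box_upd.
  have [_ D1] := is_derive_upd (dc1 i _ Iu).
  have [_ D0] := is_derive_upd (dc1 i _ Iu0).
  rewrite -{1}(upd_id r i) /q -D1 -D0.
  (* By additivity, [c1] on the parallel lines through [r] and [r0] differs by the constant [K], so
     the derivatives agree. *)
  pose K := \sum_(m < N | m != i) psi m (r 0 m) -
    \sum_(m < N | m != i) psi m (r0 0 m).
  have DK : derivable (fun s => c1 (upd r0 i s) : R^o) (r 0 i) (1 : R).
    by have [] := is_derive_upd (dc1 i _ Iu0).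
  have := deriveD DK (derivable_cst (K : R^o) (r 0 i) (1 : R)).
  rewrite derive_cst addr0 => <-; apply: near_eq_derive.
  apply: filterS (open_nbhs_nbhs (conj (I_open i) (Ir i))) => s Is.
  have Iu1 : box I (upd r i s) by exact: box_upd.
  have Iu2 : box I (upd r0 i s) by exact: box_upd.
  rewrite fctE !c1psi// !(bigD1 (P := predT) i)//= !updE eqxx -addrA.
  congr (_ + _).
  have sumE p : \sum_(m < N | m != i) psi m (upd p i s 0 m) =
      \sum_(m < N | m != i) psi m (p 0 m).
    by apply: eq_bigr => m /negbTE mi; rewrite updE mi.
  by rewrite !sumE /K addrC subrK.
have moment k : exists ck : 'rV[R]_N -> R, [/\ Cn_on (box I) 2 ck,
    forall i r, box I r ->
      partial i ck r = F i (r 0 i) ^ (k - 1) * q i (r 0 i) &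
    k = 1 -> ck = c1].
  (* For [k = 1] the given [c1] is taken itself: a potential would match it only up to a
     constant. *)
  have [->|k1] := eqVneq k 1.
    by exists c1; split => // i r Ir; rewrite subrr expr0z mul1r c1q.
  pose h i s := F i s ^ (k - 1) * q i s.
  have h1 i : C1_on (I i) (h i).
    by apply: C1_onM; [apply: C1_on_exprz; [exact: F0|]|].
  have [g hg] := exists_coord_potential I_open I_itv
    (fun i x => @C1_on_continuous R (I i) (h i) x (h1 i)).
  exists g; split => [|i r Ir|/eqP]; last by rewrite (negbTE k1).
    by apply: (Cn_on2_coord I_open h1) => i r Ir; have [] := hg i r Ir.
  by have [] := hg i r Ir.
have [c hc] := choice moment.
have cc1 : c 1 = c1 by have [_ _ ->] := hc 1.
exists c; split; last by rewrite cc1.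
split=> [k|k i r Ir]; first by have [] := hc k.
have [_ -> // _] := hc k; have [_ -> // _] := hc (k + 1).
have -> : k + 1 - 1 = 1 + (k - 1) by rewrite addrK addrC subrK.
(* The exponent may be negative, so splitting the power uses that V_i + c_1 does not vanish. *)
have FX : F i (r 0 i) ^ (1 + (k - 1)) = F i (r 0 i) * F i (r 0 i) ^ (k - 1).
  by rewrite (@expfzDr _ _ 1) ?expr1z// F0.
have VE : V i r = F i (r 0 i) - c1 r by rewrite FE// addrK.
by rewrite cc1 FX VE -[in RHS]mulrA mulrBl.
Qed.

Unset Implicit Arguments.

Theorem theorem5 (R : realType) (N : nat) (N_gt0 : (0 < N)%N)
    (I : 'I_N -> set R)
    (I_open : forall i, open (I i)) (I_itv : forall i, is_interval (I i))
    (V : 'I_N -> 'rV[R]_N -> R)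
    (V_C1 : forall i, Cn_on (box I) 1 (V i))
    (V_distinct : forall i k, i != k -> forall r, box I r -> V i r != V k r)
    (c1 : 'rV[R]_N -> R) (c1_C2 : Cn_on (box I) 2 c1) :
  (depends_on_all (box I) c1 ->
     embedded_with_first_moment (box I) V c1 -> separated_form (box I) V c1) /\
  (nonvanishing_shift (box I) V c1 ->
     separated_form (box I) V c1 -> embedded_with_first_moment (box I) V c1).
Proof.
split; first exact: embedded_separated.
exact: separated_embedded.
Qed.
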